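(* Let $l$ and $k$ be circles in the plane such that the circle $l$ lies inside $k$. Let $m_1$ and $m_2$ be two circles orthogonal to both $l$ and $k$. Then $m_1$ and $m_2$ have two intersection points.
   Context: Here ''$l$ lies inside $k$'' means that $l$ is contained in the open disc bounded by $k$, so that $l$ and $k$ do not meet. Two circles are orthogonal if they intersect at right angles. *)

(* Defs.v *)
From mathcomp Require Import all_boot all_order all_algebra.
From mathcomp Require Import classical_sets reals.

Set Implicit Arguments.
Unset Strict Implicit.
Unset Printing Implicit Defensive.

Import Order.TTheory GRing.Theory Num.Theory.

Local Open Scope ring_scope.
Local Open Scope classical_set_scope.

Section Circles.
Variable R : realType.
Implicit Types p q u v : 'rV[R]_2.

Definition dot u v : R := \sum_i u 0 i * v 0 i.

(* The library norm on row vectors is the sup norm, hence this definition. *)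
Definition edist p q : R := Num.sqrt (dot (p - q) (p - q)).

Record circle : Type := Circle {
  center : 'rV[R]_2;
  radius : R;
  radius_gt0 : 0 < radius
}.

Implicit Types c l k : circle.

Definition points c : set 'rV[R]_2 := [set p | edist p (center c) = radius c].

Definition open_disc c : set 'rV[R]_2 :=
  [set p | edist p (center c) < radius c].

Definition lies_inside l k : Prop := points l `<=` open_disc k.

(* Only meaningful when [p] lies on [c]. *)
Definition tangent_line c p : set 'rV[R]_2 :=
  [set q | dot (q - p) (p - center c) = 0].

(* [A] and [B] are meant to be lines through [p]. *)
Definition perpendicular_at p (A B : set 'rV[R]_2) : Prop :=
  forall a b, A a -> B b -> dot (a - p) (b - p) = 0.

(* The angle between two circles at a common point is the angle between their
   tangent lines there. *)
Definition orthogonal_circles c l : Prop :=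
  points c `&` points l !=set0 /\
  forall p, points c p -> points l p ->
    perpendicular_at p (tangent_line c p) (tangent_line l p).

End Circles.

(* Main.v *)
Require Import Defs.
From mathcomp Require Import all_boot all_order all_algebra.
From mathcomp Require Import classical_sets reals.
From mathcomp Require Import ring lra.

(** Write [A], [a] and [B], [b] for the centres and radii of [l] and [k].  For
    a circle [m] with centre [C] and radius [r], orthogonality to [l] and to
    [k] amounts to [|C - A|^2 = r^2 + a^2] and [|C - B|^2 = r^2 + b^2]
    ([orthogonal_centers]).  So [A] and [B] have positive powers [a^2] and
    [b^2] with respect to [m], and [C] is on the radical axis of [l] and [k].

    As [l] lies inside [k], its point farthest from [B] shows that
    [a + d < b], where [d = |A - B|] ([lies_inside_radius]).  If [d] were [0],
    the two equations would give [a = b]; hence the line of centres exists,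
    with unit vector [e] from [B] to [A].  The radical axis is perpendicular to
    it, at a point [D = A + x e] where [2 d x = b^2 - a^2 - d^2]; thus [x > a],
    that is, [D] is outside [l].  Every circle orthogonal to both [l] and [k]
    now has its centre at a point [D + t J e], where [J] is the quarter turn,
    and satisfies [r^2 = t^2 + h^2] with [h^2 = x^2 - a^2]
    ([orthogonal_in_pencil]).  So all these circles pass through the two points
    [D + h e] and [D - h e] of the line of centres, and two distinct ones share
    nothing else, since the chord common to them lies on that line
    ([pencil_common_points]). *)

Set Implicit Arguments.
Unset Strict Implicit.
Unset Printing Implicit Defensive.

Import Order.TTheory GRing.Theory Num.Theory.

Local Open Scope ring_scope.
Local Open Scope classical_set_scope.

Section PlaneVectors.
Variable R : realType.
Implicit Types (u v w e p : 'rV[R]_2) (a : R).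

Lemma dotE u v : dot u v = u 0 0 * v 0 0 + u 0 1 * v 0 1.
Proof.
rewrite /dot big_ord_recl big_ord1.
by have -> : lift ord0 ord0 = 1 :> 'I_2 by apply/val_inj.
Qed.

Lemma dotC u v : dot u v = dot v u.
Proof. by rewrite !dotE; ring. Qed.

Lemma dotDl u v w : dot (u + v) w = dot u w + dot v w.
Proof. by rewrite !dotE !mxE; ring. Qed.

Lemma dotDr u v w : dot w (u + v) = dot w u + dot w v.
Proof. by rewrite !dotE !mxE; ring. Qed.

Lemma dotNl u w : dot (- u) w = - dot u w.
Proof. by rewrite !dotE !mxE; ring. Qed.

Lemma dotNr u w : dot w (- u) = - dot w u.
Proof. by rewrite !dotE !mxE; ring. Qed.

Lemma dotZl a u w : dot (a *: u) w = a * dot u w.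
Proof. by rewrite !dotE !mxE; ring. Qed.

Lemma dotZr a u w : dot w (a *: u) = a * dot w u.
Proof. by rewrite !dotE !mxE; ring. Qed.

Definition dotL := (dotDl, dotDr, dotNl, dotNr, dotZl, dotZr).

Lemma dot_ge0 u : 0 <= dot u u.
Proof. by rewrite dotE -!expr2 addr_ge0 ?sqr_ge0. Qed.

Lemma dot_eq0 u : (dot u u == 0) = (u == 0).
Proof.
apply/idP/eqP => [|->]; last by rewrite dotE !mxE !mul0r addr0.
rewrite dotE -!expr2 paddr_eq0 ?sqr_ge0// !sqrf_eq0 => /andP[/eqP u0 /eqP u1].
apply/rowP => i; rewrite mxE; case: i => [[|[|//]] i2].
  by rewrite -[RHS]u0; congr (u 0 _); apply/val_inj.
by rewrite -[RHS]u1; congr (u 0 _); apply/val_inj.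
Qed.

Definition quarter_turn u : 'rV[R]_2 :=
  \row_i (if i == 0 then - u 0 1 else u 0 0).

Lemma dot_quarter_turn u v : dot (quarter_turn u) (quarter_turn v) = dot u v.
Proof. by rewrite !dotE !mxE /=; ring. Qed.

Lemma dot_quarter_turnl u : dot (quarter_turn u) u = 0.
Proof. by rewrite dotE !mxE /=; ring. Qed.

(** The squared length of the difference of both sides is [dot v v] minus the
    sum of the squared coordinates, which is [0] by the identity of Lagrange. *)
Lemma orthonormal_expansion e v : dot e e = 1 ->
  v = dot v e *: e + dot v (quarter_turn e) *: quarter_turn e.
Proof.
move=> e1; apply/eqP; rewrite -subr_eq0 -dot_eq0; apply/eqP.
rewrite !dotL !(dotC e) (dotC (quarter_turn e) v) dot_quarter_turn.
rewrite dot_quarter_turnl e1.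
suff -> : dot v v = dot v e ^+ 2 + dot v (quarter_turn e) ^+ 2 by ring.
rewrite -[LHS]mulr1 -e1 !dotE !mxE /=; ring.
Qed.

Lemma dot_orthonormal e v : dot e e = 1 ->
  dot v v = dot v e ^+ 2 + dot v (quarter_turn e) ^+ 2.
Proof.
by move=> e1; rewrite {2}(orthonormal_expansion v e1) !dotL; ring.
Qed.

(** The case [v = 0], with an arbitrary direction, allows the argument on
    distances in [lies_inside_radius] to cover concentric circles. *)
Lemma polar_form v : exists2 e, dot e e = 1 & v = Num.sqrt (dot v v) *: e.
Proof.
have [->|v0] := eqVneq v 0.
  exists (\row_i (i == 0)%:R); first by rewrite dotE !mxE /=; ring.
  by rewrite (eqP (_ : dot 0 0 == 0)) ?dot_eq0// sqrtr0 scale0r.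
have n0 : Num.sqrt (dot v v) != 0.
  by rewrite sqrtr_eq0 -ltNge lt_def dot_eq0 v0 dot_ge0.
exists ((Num.sqrt (dot v v))^-1 *: v); last by rewrite scalerA divff ?scale1r.
by rewrite !dotL -{3}(sqr_sqrtr (dot_ge0 v)); field.
Qed.

End PlaneVectors.

Section CirclePencil.
Variable R : realType.
Implicit Types (c l k m : circle R) (e p D : 'rV[R]_2) (d h t x : R).

Lemma pointsE c p :
  points c p <-> dot (p - center c) (p - center c) = radius c ^+ 2.
Proof.
rewrite /points /= /edist; split=> [<-|->]; first by rewrite sqr_sqrtr ?dot_ge0.
by rewrite sqrtr_sqr gtr0_norm ?radius_gt0.
Qed.

Lemma circle_inj c m : center c = center m -> radius c = radius m -> c = m.
Proof.
case: c m => [A a a0] [B b b0] /= AB ab; subst B b.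
by rewrite (bool_irrelevance a0 b0).
Qed.

(** At a common point the quarter turns of the two radius vectors are tangent
    directions, so orthogonal circles have orthogonal radius vectors and the
    theorem of Pythagoras applies. *)
Lemma orthogonal_centers c m : orthogonal_circles m c ->
  dot (center m - center c) (center m - center c)
    = radius m ^+ 2 + radius c ^+ 2.
Proof.
move=> [[p [pm pc]] orth].
have := orth p pm pc (p + quarter_turn (p - center m))
  (p + quarter_turn (p - center c)).
rewrite /tangent_line /= !(addrC p (quarter_turn _)) !addrK !dot_quarter_turnl.
rewrite dot_quarter_turn => /(_ erefl erefl) uv.
move/pointsE: pm => <-; move/pointsE: pc => <-.
have -> : center m - center c = (p - center c) - (p - center m).
  by apply/rowP => i; rewrite !mxE; ring.
move: (p - center m) (p - center c) uv => u v uv.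
by rewrite !dotL (dotC v u) uv; ring.
Qed.

(** The point of [l] farthest from the centre of [k] is at distance
    [d + radius l] from it. *)
Lemma lies_inside_radius l k d e : lies_inside l k -> dot e e = 1 ->
  0 <= d -> center l - center k = d *: e -> d + radius l < radius k.
Proof.
move=> lk e1 d0 dE.
have /lk : points l (center l + radius l *: e).
  by apply/pointsE; rewrite [center l + _]addrC addrK !dotL e1; ring.
rewrite /open_disc /= /edist addrAC dE -scalerDl !dotL e1 mulr1 -expr2 sqrtr_sqr.
by rewrite ger0_norm // addr_ge0 // ltW // radius_gt0.
Qed.

(** For a unit vector [e] and [h != 0], these are the circles through
    [D + h *: e] and [D - h *: e]: the centre is on the perpendicular bisector
    of the two points, and the theorem of Pythagoras gives the radius. *)
Definition in_pencil D e h m t : Prop :=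
  center m = D + t *: quarter_turn e /\ radius m ^+ 2 = t ^+ 2 + h ^+ 2.

(** Subtracting the equations of the two circles leaves [z (t1 - t2) = 0] for
    the coordinate [z] along [quarter_turn e]: the radical axis is the line
    through [D] directed by [e], on which both circles cut out [y^2 = h^2]. *)
Lemma pencil_common_points D e h m1 m2 t1 t2 : dot e e = 1 ->
  in_pencil D e h m1 t1 -> in_pencil D e h m2 t2 -> t1 <> t2 ->
  points m1 `&` points m2 = [set D + h *: e; D - h *: e].
Proof.
move=> e1 m1P m2P t12.
have on_pencil m t p : in_pencil D e h m t -> points m p <->
    dot (p - D) e ^+ 2 + dot (p - D) (quarter_turn e) ^+ 2
      - 2 * t * dot (p - D) (quarter_turn e) = h ^+ 2.
  move=> [cm rm]; rewrite pointsE cm rm opprD addrA.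
  move: (p - D) => v.
  rewrite !dotL (dot_orthonormal v e1) (dotC (quarter_turn e) v) dot_quarter_turn e1.
  by split=> H; lra.
apply/seteqP; split=> p /=.
  move=> [/(on_pencil _ _ _ m1P) p1 /(on_pencil _ _ _ m2P) p2].
  have z0 : dot (p - D) (quarter_turn e) = 0.
    have : (t1 - t2) * dot (p - D) (quarter_turn e) = 0 by lra.
    by move/eqP; rewrite mulf_eq0 subr_eq0 => /orP[/eqP//|/eqP].
  have pD : p = D + dot (p - D) e *: e.
    have := orthonormal_expansion (p - D) e1.
    by rewrite z0 scale0r addr0 => <-; rewrite addrC subrK.
  have /eqP : dot (p - D) e ^+ 2 = h ^+ 2 by rewrite -p1 z0; ring.
  rewrite eqf_sqr => /orP[] /eqP yE; rewrite yE in pD; first by left.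
  by right; rewrite pD scaleNr.
by case=> ->; split; apply/on_pencil; try eassumption;
  rewrite [D + _]addrC addrK !dotL (dotC e (quarter_turn e)) dot_quarter_turnl e1; ring.
Qed.

(** Subtracting the two orthogonality equations fixes the coordinate of the
    centre of [m] along [e]: this is the equation of the radical axis of [l]
    and [k]. *)
Lemma orthogonal_in_pencil l k m d e x h : dot e e = 1 -> d != 0 ->
  center l - center k = d *: e ->
  2 * d * x = radius k ^+ 2 - radius l ^+ 2 - d ^+ 2 ->
  h ^+ 2 = x ^+ 2 - radius l ^+ 2 ->
  orthogonal_circles m l -> orthogonal_circles m k ->
  exists t, in_pencil (center l + x *: e) e h m t.
Proof.
move=> e1 d0 dE xE hE /orthogonal_centers ml /orthogonal_centers.
have -> : center m - center k = (center m - center l) + d *: e.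
  by rewrite -dE addrA subrK.
have : center m = center l + (center m - center l) by rewrite addrC subrK.
(* [v] is made opaque so that [dotL] does not expand the difference in it. *)
move: (center m - center l) ml => v ml cm mk.
have vx : dot v e = x.
  apply: (mulfI (_ : 2 * d != 0)); first by rewrite mulf_neq0 ?pnatr_eq0.
  by move: mk; rewrite !dotL (dotC e v) ml e1; lra.
exists (dot v (quarter_turn e)); split.
  by rewrite -addrA -vx -orthonormal_expansion.
by have := dot_orthonormal v e1; rewrite ml vx hE; lra.
Qed.

End CirclePencil.

Theorem lemma4p1 (R : realType) (l k m1 m2 : circle R)
  (l_in_k : lies_inside l k)
  (m1l : orthogonal_circles m1 l) (m1k : orthogonal_circles m1 k)
  (m2l : orthogonal_circles m2 l) (m2k : orthogonal_circles m2 k)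
  (m1_neq_m2 : m1 <> m2) :
  exists p q : 'rV[R]_2, p <> q /\ points m1 `&` points m2 = [set p; q].
Proof.
have [e e1] := polar_form (center l - center k).
set d := Num.sqrt _ => dE.
have d0 : 0 <= d by apply: sqrtr_ge0.
have a0 := radius_gt0 l; have b0 := radius_gt0 k.
have dab : d + radius l < radius k := lies_inside_radius l_in_k e1 d0 dE.
have {d0} d_gt0 : 0 < d.
  rewrite lt_def d0 andbT; apply/eqP => dz.
  (* Concentric [l] and [k] would have equal radii. *)
  move: dE; rewrite dz scale0r => /eqP; rewrite subr_eq0 => /eqP lk.
  have := orthogonal_centers m1l; rewrite lk (orthogonal_centers m1k).
  by move: dab; rewrite dz; nra.
pose x := (radius k ^+ 2 - radius l ^+ 2 - d ^+ 2) / (2 * d).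
have xE : 2 * d * x = radius k ^+ 2 - radius l ^+ 2 - d ^+ 2.
  by rewrite mulrC divfK // mulf_neq0 ?pnatr_eq0 // gt_eqF.
have ax : radius l < x.
  (* [2 d (x - a) = b^2 - (a + d)^2], where [a] and [b] are the radii of [l] and [k]. *)
  by rewrite ltr_pdivlMr ?mulr_gt0 //; nra.
pose h := Num.sqrt (x ^+ 2 - radius l ^+ 2).
have h_gt0 : 0 < h by rewrite sqrtr_gt0; nra.
have hE : h ^+ 2 = x ^+ 2 - radius l ^+ 2 by rewrite sqr_sqrtr //; nra.
have pencil m := @orthogonal_in_pencil R l k m d e x h e1 (lt0r_neq0 d_gt0) dE xE hE.
have [t1 m1P] := pencil m1 m1l m1k.
have [t2 m2P] := pencil m2 m2l m2k.
exists (center l + x *: e + h *: e), (center l + x *: e - h *: e); split.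
  move=> /addrI /(congr1 (dot e)); rewrite !dotL e1 mulr1.
  by move: h_gt0; lra.
apply: (pencil_common_points e1 m1P m2P) => t12; apply: m1_neq_m2.
case: m1P m2P => [c1 r1] [c2 r2]; apply: circle_inj; first by rewrite c1 c2 t12.
by apply/eqP; rewrite -(@eqrXn2 _ 2) ?ltW ?radius_gt0 // r1 r2 t12.
Qed.
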